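(* Fix a positive integer $n$. For $j_1,j_2\in\{0,1,2,\dots,3n-1\}$ with $j_1\not\equiv j_2\pmod 3$, let $j_3\in\{0,1,2,\dots,3n-1\}$ be such that $3n$ divides $j_1+j_2+j_3$. Then the three needles with slopes $\tan(-\pi j_1/3n)$, $\tan(-\pi j_2/3n)$ and $\tan(-\pi j_3/3n)$ are concurrent, and meet at the point $e^{2\pi i j_1/3n}+e^{2\pi i j_2/3n}+e^{2\pi i j_3/3n}$. Moreover, $p_n\bigl(e^{2\pi i j_1/3n}+e^{2\pi i j_2/3n}+e^{2\pi i j_3/3n}\bigr)=0$. In fact, the equation $p_n(z)=0$ (with $z\in D$) has exactly $n^2$ solutions, all of which can be obtained in this manner.
   Context: $D=\{z\in\mathbb{C}: z^2\bar z^2-4(z^3+\bar z^3)+18z\bar z-27\le 0\}$ is the set of points on or inside the standard deltoid $\{2e^{i\varphi}+e^{-2i\varphi}:\varphi\in\mathbb{R}\}$. For each $z\in D$ there is a unique multiset $\{z_1,z_2,z_3\}$ of complex numbers with $|z_1|=|z_2|=|z_3|=z_1z_2z_3=1$ and $z_1+z_2+z_3=z$ (namely the roots $t$ of $t^3-zt^2+\bar z t-1=0$). For an integer $n$, $p_n:D\to D$ is defined by $p_n(z)=z_1^n+z_2^n+z_3^n$. For real $\theta$, the needle with slope $\tan\theta$ is the line segment $\{2\lambda e^{i\theta}+e^{-2i\theta}:-1\le\lambda\le1\}$ in $\mathbb{C}$ (it is vertical when $\cos\theta=0$, i.e. when $\tan\theta$ is undefined); it depends only on $\theta$ modulo $\pi$.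 *)

(* Defs.v *)
From mathcomp Require Import all_boot all_order all_algebra.
From mathcomp Require Import complex.
From mathcomp Require Import all_classical all_reals all_analysis.

Set Implicit Arguments.
Unset Strict Implicit.
Unset Printing Implicit Defensive.

Import Order.TTheory GRing.Theory Num.Theory.

Local Open Scope classical_set_scope.
Local Open Scope ring_scope.
Local Open Scope complex_scope.

(* e^{i x} *)
Definition cis (R : realType) (x : R) : R[i] := cos x +i* sin x.

(* The left-hand side is real for every z, and the order of R[i] restricted
   to the reals is the usual one. *)
Definition deltoid (R : realType) : set R[i] :=
  [set z | z ^+ 2 * (z^*) ^+ 2 - 4 * (z ^+ 3 + (z^*) ^+ 3)
           + 18 * z * z^* - 27 <= 0].

(* The enumerations (z1, z2, z3) of the multiset attached to z; for z in the
   deltoid they exist and are unique up to order. *)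
Definition unit_triples (R : realType) (z : R[i]) : set (3.-tuple R[i]) :=
  [set t : 3.-tuple R[i] | [/\ forall u, u \in t -> `|u| = 1,
               \prod_(u <- t) u = 1 & \sum_(u <- t) u = z]].

(* The map p_n is meant on the deltoid only: elsewhere unit_triples z is empty
   and xget returns its default value. *)
Definition p (R : realType) (n : int) (z : R[i]) : R[i] :=
  \sum_(u <- xget [tuple of nseq 3 0] (unit_triples z)) u ^ n.

(* The needle with slope tan x, vertical when cos x = 0. *)
Definition needle (R : realType) (x : R) : set R[i] :=
  [set z | exists l : R,
     -1 <= l <= 1 /\ z = (2 * l)%:C * cis x + cis (- (2 * x))].

Definition admissible (n : nat) (j1 j2 j3 : 'I_(3 * n)) : Prop :=
  (j1 != j2 %[mod 3])%N /\ (3 * n %| j1 + j2 + j3)%N.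

Definition needle_angle (R : realType) (n j : nat) : R :=
  - (pi * j%:R / (3 * n)%:R).

Definition meeting_point (R : realType) (n j1 j2 j3 : nat) : R[i] :=
  let e j := cis (2 * pi * j%:R / (3 * n)%:R) in e j1 + e j2 + e j3.

(* Main.v *)
Require Import Defs.
From mathcomp Require Import all_boot all_order all_algebra.
From mathcomp Require Import complex ring lra zify.
From mathcomp Require Import all_classical all_reals all_analysis.

(** The point [z] of the deltoid attached to a triple [a, b, c] of unit complex
    numbers with product 1 determines the triple up to order: since inverses
    are conjugates on the unit circle, the elementary symmetric functions of
    the triple are [z], its conjugate, and 1, so that [a, b, c] are the roots
    of [X^3 - z X^2 + z^* X - 1] ([unit_triple_poly]).  The polynomial defining
    the deltoid is the discriminant of this cubic.  It is nonpositive when the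
    roots are on the unit circle ([unit_triple_deltoid]); conversely the roots
    are stable under [a |-> 1 / a^*], and a root off the circle would make the
    discriminant a positive real number ([deltoid_unit_triple]).  So [p n z]
    can be computed from any unit triple with sum [z] ([p_unit_triple]).

    If [p n z = 0], the [n]-th powers of the triple form a unit triple with
    sum 0.  So do the three cube roots of unity, hence by uniqueness the powers
    are these cube roots, and the triple consists of one [n]-th root of each
    cube root of unity, with product 1.  The [n]-th roots of 1 and of [w], a
    primitive cube root of unity, can be chosen freely and determine the third
    number; conversely they are recovered from the triple by looking at [n]-th
    powers ([deltoid_zeroP], [triple_sum_zero], [triple_sum_inj]).  This gives
    [n ^ 2] zeros.  In terms of [zeta = e^(2 i pi / 3 n)] the [n]-th roots of
    cube roots of unity are the powers of [zeta], the residue of the exponent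
    modulo 3 telling which cube root; this is the indexing by the [j]s.

    As for the needles, if [a] is the inverse square of the direction [q] of
    a needle, then [b * c = q ^ 2], so [(b + c) / q] is its own conjugate; thus
    [a + b + c] differs from [a] by a real multiple of [q] and is on the needle
    ([needle_unit_triple]).  Needles with different slopes have at most one
    common point ([needles_meet_once]).  *)

Import Order.TTheory GRing.Theory Num.Theory.

Local Open Scope classical_set_scope.
Local Open Scope ring_scope.
Local Open Scope card_scope.

(** * The unit circle *)

Section UnitCircle.
Context {R : realType}.
Implicit Types (x y : R) (u z : R[i]).

Lemma cisD x y : cis (x + y) = cis x * cis y.
Proof. by apply/eqP; rewrite eq_complex /= cosD sinD addrC [_ * _ + _]addrC !eqxx. Qed.

Lemma cis0 : cis 0 = 1 :> R[i].
Proof. by rewrite /cis cos0 sin0. Qed.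

Lemma norm_cis x : `|cis x| = 1.
Proof. by rewrite normc_def /= cos2Dsin2 sqrtr1. Qed.

Lemma cisMn x k : cis (x * k%:R) = cis x ^+ k.
Proof.
elim: k => [|k IH]; first by rewrite mulr0 cis0.
by rewrite -natr1 mulrDr mulr1 cisD IH exprSr.
Qed.

Lemma cis2pi : cis (2 * pi) = 1 :> R[i].
Proof. by rewrite /cis mulr_natl cos2pi sin2pi. Qed.

(** By the double-angle formula, [cos x = 1] forces [sin (x / 2) = 0]. *)
Lemma cis_neq1 x : 0 < x < 2 * pi -> cis x != 1.
Proof.
move=> /andP[x0 x2].
have s0 : 0 < sin (x / 2) by apply: sin_gt0_pi; apply/andP; split; lra.
apply/negP => /eqP[+ _]; rewrite (_ : x = (x / 2) *+ 2); last by rewrite -mulr_natr; field.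
by rewrite cos_mulr2n cos2sin2 => h; have := exprn_gt0 2 s0; rewrite -mulr_natr in h; lra.
Qed.

Lemma prim_root_cis N : (0 < N)%N -> N.-primitive_root (cis (2 * pi / N%:R : R)).
Proof.
move=> N0; apply/andP; split=> //; apply/forallP => i.
have NR : 0 < N%:R :> R by rewrite ltr0n.
rewrite unity_rootE -cisMn; apply/eqP.
have [->|iN] := eqVneq i.+1 N.
  by rewrite divfK ?lt0r_neq0 // cis2pi eqxx.
apply/negbTE/cis_neq1/andP; split.
  by rewrite mulr_gt0 ?ltr0n // divr_gt0 // mulr_gt0 ?pi_gt0.
rewrite mulrAC ltr_pdivrMr // ltr_pM2l ?mulr_gt0 ?pi_gt0 // ltr_nat.
by rewrite ltn_neqAle iN ltn_ord.
Qed.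

Lemma norm1_conj u : `|u| = 1 -> u^* = u^-1.
Proof.
move=> u1; have u0 : u != 0 by rewrite -normr_eq0 u1 oner_eq0.
by apply: (mulfI u0); rewrite mulfV // -normCK u1 expr1n.
Qed.

Lemma conj_norm1 u : u * u^* = 1 -> `|u| = 1.
Proof. by rewrite -normCK => /eqP; rewrite sqrp_eq1 // => /eqP. Qed.

Lemma norm1_neq0 u : `|u| = 1 -> u != 0.
Proof. by move=> u1; rewrite -normr_eq0 u1 oner_eq0. Qed.

End UnitCircle.

(** * Unit triples and the deltoid *)

Section UnitTriples.
Context {R : realType}.
Implicit Types (a b c z : R[i]).

Lemma unit_triplesE z a b c : unit_triples z [tuple a; b; c] <->
  [/\ `|a| = 1, `|b| = 1, `|c| = 1, a * b * c = 1 & a + b + c = z].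
Proof.
rewrite /unit_triples /= !big_cons !big_nil mulr1 addr0 mulrA addrA; split.
  by case=> h ? ?; split=> //; apply: h; rewrite !inE eqxx ?orbT.
by case=> ? ? ? ? ?; split=> // u; rewrite !inE => /or3P[] /eqP->.
Qed.

Lemma tuple3_eta (t : 3.-tuple R[i]) : exists a b c, t = [tuple a; b; c].
Proof.
case/tupleP: t => a t; case/tupleP: t => b t; case/tupleP: t => c t.
by exists a, b, c; rewrite (tuple0 t); apply/val_inj.
Qed.

Lemma unit_triple_conj {a b c} : `|a| = 1 -> `|b| = 1 -> `|c| = 1 ->
  a * b * c = 1 -> (a + b + c)^* = a * b + b * c + c * a.
Proof.
move=> a1 b1 c1 abc; rewrite !rmorphD /= !norm1_conj //.
have -> : c = (a * b)^-1.
  have ab0 : a * b != 0 by rewrite mulf_neq0 ?norm1_neq0.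
  by apply: (mulfI ab0); rewrite abc mulfV.
by field; rewrite !norm1_neq0.
Qed.

(** The coefficients are symmetric functions of the triple, and the second one
    is the conjugate of the first because the triple has product 1. *)
Lemma unit_triple_poly z (t : 3.-tuple R[i]) : unit_triples z t ->
  \prod_(u <- t) ('X - u%:P) = 'X^3 - z%:P * 'X^2 + z^*%:P * 'X - 1.
Proof.
move=> zt; have [a [b [c tE]]] := tuple3_eta t; subst t.
move/unit_triplesE: zt => [a1 b1 c1 abc <-].
rewrite (unit_triple_conj a1 b1 c1 abc).
rewrite !big_cons big_nil -[X in _ = _ - X]/(1%:P) -abc !polyCM.
ring.
Qed.

Lemma unit_triple_unique z (t t' : 3.-tuple R[i]) :
  unit_triples z t -> unit_triples z t' -> perm_eq t t'.
Proof.
move=> zt zt'; apply: prod_XsubC_eq.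
by rewrite (unit_triple_poly _ _ zt) (unit_triple_poly _ _ zt').
Qed.

(** Uniqueness makes the arbitrary choice in the definition of [p] harmless. *)
Lemma p_unit_triple (n : nat) z (t : 3.-tuple R[i]) : unit_triples z t ->
  p n z = \sum_(u <- t) u ^+ n.
Proof.
move=> zt; rewrite /p; case: xgetP => [t' _ zt'|/(_ _ zt)//].
by apply: perm_big; apply: unit_triple_unique zt' zt.
Qed.

(** The discriminant of the monic cubic with roots [a, b, c], in terms of its
    coefficients. *)
Lemma deltoid_discriminant a b c : a * b * c = 1 ->
  let z := a + b + c in let z' := a * b + b * c + c * a in
  z ^+ 2 * z' ^+ 2 - 4 * (z ^+ 3 + z' ^+ 3) + 18 * z * z' - 27
  = ((a - b) * (b - c) * (c - a)) ^+ 2.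
Proof.
move=> abc /=.
(* Homogeneous of degree 6 once multiplied by powers of [a * b * c]. *)
transitivity ((a + b + c) ^+ 2 * (a * b + b * c + c * a) ^+ 2
 - 4 * ((a + b + c) ^+ 3 * (a * b * c) + (a * b + b * c + c * a) ^+ 3)
 + 18 * (a + b + c) * (a * b + b * c + c * a) * (a * b * c)
 - 27 * (a * b * c) ^+ 2); last by ring.
by rewrite abc expr1n !mulr1.
Qed.

(** The square root [d = (a - b) (b - c) (c - a)] of the discriminant is purely
    imaginary: replacing each root by its inverse changes the sign of each
    difference and divides the product by [(a b c) ^ 2 = 1]. *)
Lemma unit_triple_deltoid z t : unit_triples z t -> deltoid z.
Proof.
move=> zt; have [a [b [c tE]]] := tuple3_eta t; subst t.
move/unit_triplesE: zt => [a1 b1 c1 abc <-].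
rewrite /deltoid /= (unit_triple_conj a1 b1 c1 abc) (deltoid_discriminant _ _ _ abc).
set d := (a - b) * _ * _.
suff dc : d^* = - d by rewrite expr2 -[X in _ * X]opprK -dc mulrN oppr_le0 mul_conjC_ge0.
have -> : d^* = d^* * (a * b * c) ^+ 2 by rewrite abc expr1n mulr1.
rewrite /d !rmorphM !rmorphB /= !norm1_conj //.
by field; rewrite !norm1_neq0.
Qed.

(** If [b] is the reflection [1 / a^*] of [a], then [c = a^* / a], and up to the
    positive factor [|a| ^ 4] the square root of the discriminant is the real
    number [(|a| ^ 2 - 1) |a - a^* ^ 2| ^ 2].  Having a nonpositive square, it
    vanishes, and [a = a^* ^ 2] also implies [|a| = 1]. *)
Lemma reciprocal_root_norm1 a b c : a * b * c = 1 -> b * a^* = 1 ->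
  ((a - b) * (b - c) * (c - a)) ^+ 2 <= 0 -> a * a^* = 1.
Proof.
move=> abc ba D.
have a0 : a != 0.
  by apply/eqP => a0; move/eqP: abc; rewrite a0 !mul0r eq_sym oner_eq0.
have ac0 : a^* != 0 by rewrite conjC_eq0.
have ca : c * a = a^*.
  by rewrite -[LHS]mulr1 -ba -[RHS]mul1r -abc; ring.
pose s := (a * a^* - 1) * ((a - a^* ^+ 2) * (a - a^* ^+ 2)^*).
have sE : s = (a - b) * (b - c) * (c - a) * (a * a^*) ^+ 2.
  rewrite /s rmorphB rmorphXn /= conjCK.
  have -> : a * a^* - 1 = (a - b) * a^* by rewrite mulrBl ba.
  have -> : a^* - a ^+ 2 = (c - a) * a by rewrite mulrBl ca.
  have -> : a - a^* ^+ 2 = (b - c) * (a * a^*).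
    by rewrite mulrBl mulrCA ba mulrA ca mulr1.
  ring.
have sr : s^* = s.
  by rewrite /s !(rmorphM, rmorphB, rmorphXn, rmorph1, conjCK) /= !conjCK; ring.
have s2 : s * s^* <= 0.
  rewrite sr -expr2 sE exprMn mulr_le0_ge0 //.
  by rewrite !exprn_ge0 // mul_conjC_ge0.
have {s2} : s == 0.
  by rewrite -normr_eq0 -sqrf_eq0 normCK eq_le s2 mul_conjC_ge0.
rewrite mulf_eq0 subr_eq0 => /orP[/eqP//|].
rewrite -normCK sqrf_eq0 normr_eq0 subr_eq0 => /eqP aE.
have aE' : a^* = a ^+ 2 by rewrite {1}aE rmorphXn /= conjCK.
have aa0 : a * a^* != 0 by rewrite mulf_neq0.
apply: (mulfI aa0); rewrite mulr1.
by transitivity (a^* ^+ 2 * a ^+ 2); [ring | rewrite -aE -aE'].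
Qed.

(** The cubic splits over the complex numbers; evaluating it at 0, 1 and -1
    gives three linear equations that determine its symmetric functions. *)
Lemma cubic_roots z : exists a b c,
  [/\ a + b + c = z, a * b + b * c + c * a = z^* & a * b * c = 1].
Proof.
pose P : {poly R[i]} := Poly [:: -1; z^*; -z; 1].
have PE : (P : seq R[i]) = [:: -1; z^*; -z; 1] by rewrite (PolyK (c := 0)) //= oner_eq0.
have [s Ps] := closed_field_poly_normal P.
have lP : lead_coef P = 1 by rewrite lead_coefE PE.
rewrite lP scale1r in Ps.
have : size s = 3 by apply/eqP; rewrite -eqSS -(size_prod_XsubC _ id) -Ps PE.
case: s Ps => [|a [|b [|c [|]]]] // Ps _; exists a, b, c.
have H x : P.[x] = (x - a) * ((x - b) * (x - c)).
  by rewrite Ps !big_cons big_nil !hornerM !hornerXsubC hornerC mulr1.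
have HP x : P.[x] = x ^+ 3 - z * x ^+ 2 + z^* * x - 1.
  by rewrite /horner PE /=; ring.
have := H 0; have := H 1; have := H (-1); rewrite !HP => h1 h2 h3.
have e3 : a * b * c = 1.
  apply/eqP; rewrite -subr_eq0; apply/eqP.
  have -> : 1 = - (0 ^+ 3 - z * 0 ^+ 2 + z^* * 0 - 1) by ring.
  by rewrite h3; ring.
have two : (2 : R[i]) != 0 by rewrite pnatr_eq0.
split=> //; apply: (mulfI two).
  transitivity (- ((1 - a) * ((1 - b) * (1 - c))
                   + (-1 - a) * ((-1 - b) * (-1 - c))) - 2 * (a * b * c)).
    by ring.
  by rewrite -h1 -h2 e3; ring.
transitivity ((1 - a) * ((1 - b) * (1 - c))
              - (-1 - a) * ((-1 - b) * (-1 - c)) - 2).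
  by ring.
by rewrite -h1 -h2; ring.
Qed.

(** The cubic with roots [a, b, c] is, up to a constant, its own conjugate
    reciprocal, so the reflection [1 / a^*] of a root is a root. *)
Lemma conj_reciprocal_root a b c : a * b * c = 1 ->
  (a + b + c)^* = a * b + b * c + c * a ->
  [|| a * a^* == 1, b * a^* == 1 | c * a^* == 1].
Proof.
move=> abc; set s1 := a + b + c; set s2 := a * b + b * c + c * a => e.
have e' : s2^* = s1 by rewrite -e conjCK.
have /(congr1 Num.conj) : a ^+ 3 - s1 * a ^+ 2 + s2 * a - 1 = 0.
  by rewrite -abc /s1 /s2; ring.
rewrite rmorph0 rmorphB rmorphD rmorphB !(rmorphXn, rmorphM) rmorph1 /= e e' => aroot.
suff : (a * a^* - 1) * ((b * a^* - 1) * (c * a^* - 1)) = 0.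
  by move/eqP; rewrite !mulf_eq0 !subr_eq0.
transitivity (a * b * c * a^* ^+ 3 - s2 * a^* ^+ 2 + s1 * a^* - 1).
  by rewrite /s1 /s2; ring.
rewrite abc mul1r; exact: aroot.
Qed.

Lemma deltoid_root_norm1 a b c : a * b * c = 1 ->
  (a + b + c)^* = a * b + b * c + c * a ->
  ((a - b) * (b - c) * (c - a)) ^+ 2 <= 0 -> `|a| = 1.
Proof.
move=> abc e D; apply: conj_norm1.
have /or3P[/eqP//|/eqP h|/eqP h] := conj_reciprocal_root _ _ _ abc e.
  exact: reciprocal_root_norm1 abc h D.
have acb : a * c * b = 1 by rewrite mulrAC.
apply: reciprocal_root_norm1 acb h _.
have -> : (a - c) * (c - b) * (b - a) = - ((a - b) * (b - c) * (c - a)) by ring.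
by rewrite sqrrN.
Qed.

Lemma deltoid_unit_triple z : deltoid z -> exists t, unit_triples z t.
Proof.
have [a [b [c [<- e abc]]]] := cubic_roots z.
rewrite /deltoid /= -e (deltoid_discriminant _ _ _ abc) => D.
have rot u v w : u + v + w = v + w + u :> R[i] by rewrite -addrA addrC.
have abc' : b * c * a = 1 by rewrite mulrC mulrA.
have abc'' : c * a * b = 1 by rewrite -mulrA mulrC.
have D' : ((b - c) * (c - a) * (a - b)) ^+ 2 <= 0 by rewrite mulrC mulrA.
have D'' : ((c - a) * (a - b) * (b - c)) ^+ 2 <= 0 by rewrite -mulrA mulrC.
have e' : (b + c + a)^* = b * c + c * a + a * b by rewrite -(rot a) -(rot (a * b)) e.
have e'' : (c + a + b)^* = c * a + a * b + b * c by rewrite -(rot b) -(rot (b * c)) e'.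
exists [tuple a; b; c]; apply/unit_triplesE; split=> //.
- exact: deltoid_root_norm1 abc (esym e) D.
- exact: deltoid_root_norm1 abc' e' D'.
- exact: deltoid_root_norm1 abc'' e'' D''.
Qed.

End UnitTriples.

(** * Needles *)

Section Needles.
Context {R : realType}.
Implicit Types (x y : R) (a b c z : R[i]).

(** The parameter of the point on the needle is [(b + c) / (2 cis x)], which equals
    its own conjugate because [b * c = cis x ^ 2], and is bounded by 1 by the triangle
    inequality. *)
Lemma needle_unit_triple x a b c : unit_triples (a + b + c) [tuple a; b; c] ->
  a = cis (- (2 * x)) -> needle x (a + b + c).
Proof.
move=> /unit_triplesE[a1 b1 c1 abc _] ax.
set q := cis x; have q1 : `|q| = 1 := norm_cis x.
have q2 : q ^+ 2 = b * c.
  apply: (mulfI (norm1_neq0 _ a1)).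
  by rewrite [RHS]mulrA abc ax expr2 -!cisD (_ : _ + _ = 0) ?cis0 //; ring.
have q0 := norm1_neq0 _ q1.
pose w := (b + c) / q.
have /complex_realP[r wr] : w \is Num.real.
  apply/CrealP; rewrite /w rmorphM rmorphD fmorphV /= !norm1_conj // invrK.
  apply: (mulIf q0); rewrite divfK // -mulrA -expr2 q2.
  by field; rewrite !norm1_neq0.
have bc : b + c = r%:C%C * q by rewrite -wr divfK.
exists (r / 2); split; last first.
  by rewrite -ax mulrCA divff ?pnatr_eq0 // mulr1 -addrA addrC bc.
suff : `|r| <= 2 by rewrite ler_norml => /andP[]; lra.
rewrite -lecR; apply: le_trans (normc_ge_Re r%:C%C) _; rewrite -wr.
rewrite /w normrM normfV q1 invr1 mulr1 rmorphMn rmorph1 mulr2n.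
by apply: le_trans (ler_normD _ _) _; rewrite b1 c1.
Qed.

(** Otherwise the directions [cis x] and [cis y] would be real multiples of each
    other, hence equal up to sign, and have the same square. *)
Lemma needles_meet_once x y z z' : cis (2 * x) != cis (2 * y) ->
  needle x z -> needle y z -> needle x z' -> needle y z' -> z = z'.
Proof.
move=> xy [l [_ zx]] [m [_ zy]] [l' [_ zx']] [m' [_ zy']].
have ex : z - z' = (2 * (l - l'))%:C%C * cis x by rewrite zx zx' mulrBr rmorphB /=; ring.
have ey : z - z' = (2 * (m - m'))%:C%C * cis y by rewrite zy zy' mulrBr rmorphB /=; ring.
have [lm|lm] := eqVneq (2 * (l - l')) 0.
  by apply/eqP; rewrite -subr_eq0 ex lm mul0r.
case/eqP: xy.
pose r : R := 2 * (m - m') / (2 * (l - l')).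
have lmC : (2 * (l - l'))%:C%C != 0 :> R[i] by rewrite fmorph_eq0.
have cxy : cis x = r%:C%C * cis y.
  by apply: (mulfI lmC); rewrite -ex ey mulrA -rmorphM /r [2 * (l - l') * _]mulrC divfK.
have r1 : `|r| = 1.
  have /(congr1 (fun u => `|u|)) := cxy.
  rewrite normrM !norm_cis mulr1 normc_def /= expr0n addr0 sqrtr_sqr.
  by move/esym/complexI.
rewrite !mulr_natl !mulr2n !cisD cxy mulrACA -rmorphM -expr2 -real_normK ?num_real //.
by rewrite r1 expr1n mul1r.
Qed.

End Needles.

(** * Zeros of p_n as sums of roots of cube roots of unity *)

Section Zeros.
Context {R : realType}.
Implicit Types (x y z w : R[i]).

(** The point of the deltoid whose unit triple contains [x] and [y], the third
    number being forced by the product. *)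
Definition triple_sum x y := x + y + (x * y)^-1.

Lemma triple_sumP x y : `|x| = 1 -> `|y| = 1 ->
  unit_triples (triple_sum x y) [tuple x; y; (x * y)^-1].
Proof.
move=> x1 y1; apply/unit_triplesE; split=> //.
  by rewrite normfV normrM x1 y1 mulr1 invr1.
by rewrite mulfV // mulf_neq0 ?norm1_neq0.
Qed.

Lemma unit_triple_sum z (t : 3.-tuple R[i]) x y : unit_triples z t ->
  x \in t -> y \in t -> x != y -> [/\ `|x| = 1, `|y| = 1 & z = triple_sum x y].
Proof.
move=> zt; have [a [b [c tE]]] := tuple3_eta t; subst t.
move/unit_triplesE: zt => [a1 b1 c1 abc <-].
have inv u v w : u * v * w = 1 -> (u * v)^-1 = w.
  move=> uvw; have uv0 : u * v != 0.
    by apply/eqP => uv0; move/eqP: uvw; rewrite uv0 mul0r eq_sym oner_eq0.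
  by apply: (mulfI uv0); rewrite mulfV.
rewrite /triple_sum !inE => /or3P[] /eqP-> /or3P[] /eqP->;
  rewrite ?eqxx // => _; split=> //.
- by rewrite (inv a b c).
- by rewrite (inv a c b); [ring | rewrite -abc; ring].
- by rewrite (inv b a c); [ring | rewrite -abc; ring].
- by rewrite (inv b c a); [ring | rewrite -abc; ring].
- by rewrite (inv c a b); [ring | rewrite -abc; ring].
- by rewrite (inv c b a); [ring | rewrite -abc; ring].
Qed.

(** The factor [x - y] of [x ^ 3 - y ^ 3 = 0] cancels, leaving
    [x ^ 2 + x y + y ^ 2 = 0]; times [x], and with [1 = x ^ 3], this is the claim
    multiplied by [x y]. *)
Lemma cube_roots_sum x y : x ^+ 3 = 1 -> y ^+ 3 = 1 -> x != y ->
  x + y + (x * y)^-1 = 0.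
Proof.
move=> x3 y3 xy.
have n0 (u : R[i]) : u ^+ 3 = 1 -> u != 0.
  by move=> u3; apply/eqP => u0; move/eqP: u3; rewrite u0 expr0n eq_sym oner_eq0.
have h : x ^+ 2 + x * y + y ^+ 2 = 0.
  have /mulfI : x - y != 0 by rewrite subr_eq0.
  apply; rewrite mulr0.
  by transitivity (x ^+ 3 - y ^+ 3); [ring | rewrite x3 y3 subrr].
have xy0 : x * y != 0 by rewrite mulf_neq0 ?n0.
apply: (mulfI xy0); rewrite mulrDr mulfV // mulr0 -x3.
transitivity (x * (x ^+ 2 + x * y + y ^+ 2)); first by ring.
by rewrite h mulr0.
Qed.

Lemma root_unity_norm1 (k : nat) x : (0 < k)%N -> x ^+ k = 1 -> `|x| = 1.
Proof.
move=> k0 xk; apply/eqP; rewrite -(pexpr_eq1 (n := k)) //.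
by rewrite -normrX xk normr1.
Qed.

Variables (n : nat) (n_gt0 : (0 < n)%N) (w : R[i]).
Hypothesis w3 : 3.-primitive_root w.

Let w_cube : w ^+ 3 = 1 := prim_expr_order w3.

Let w_neq1 : w != 1.
Proof. by have := eq_prim_root_expr w3 1 0; rewrite expr1 => ->. Qed.

Let w_unit : `|w| = 1 := root_unity_norm1 3 w isT w_cube.

Let root_of_w_norm1 y : y ^+ n = w -> `|y| = 1.
Proof.
move=> yw; apply: (root_unity_norm1 (n * 3)); first by rewrite muln_gt0 n_gt0.
by rewrite exprM yw.
Qed.

(** The [n]-th powers of the triple of [z] form a unit triple with sum 0, as do
    the cube roots of unity: by uniqueness both are the same up to order. *)
Lemma deltoid_zeroP z : deltoid z -> p n z = 0 -> exists x y,
  [/\ x ^+ n = 1, y ^+ n = w & z = triple_sum x y].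
Proof.
move=> /deltoid_unit_triple[t zt]; rewrite (p_unit_triple _ _ _ zt) => pz.
pose t' := [tuple of map (fun u => u ^+ n) t].
have zt' : unit_triples 0 t'.
  case: zt => t1 tp _; split.
  - by move=> _ /mapP[u ut ->]; rewrite normrX t1 // expr1n.
  - by rewrite big_map prodrXl tp expr1n.
  - by rewrite big_map.
have cube0 : unit_triples 0 [tuple 1; w; (1 * w)^-1].
  rewrite -[X in unit_triples X](cube_roots_sum 1 w (expr1n _ 3) w_cube) //;
    last by rewrite eq_sym.
  by apply: triple_sumP; rewrite ?normr1.
have tw := perm_mem (unit_triple_unique _ _ _ zt' cube0).
have /mapP[x xt x1] : 1 \in t' by rewrite tw mem_head.
have /mapP[y yt yw] : w \in t' by rewrite tw !inE eqxx orbT.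
exists x, y; split=> //.
have [|_ _ ->//] := unit_triple_sum _ _ x y zt xt yt.
by apply: contraNneq w_neq1 => xy; rewrite yw -xy -x1.
Qed.

Lemma triple_sum_zero x y : x ^+ n = 1 -> y ^+ n = w ->
  deltoid (triple_sum x y) /\ p n (triple_sum x y) = 0.
Proof.
move=> xn yn.
have x1 : `|x| = 1 := root_unity_norm1 _ _ n_gt0 xn.
have xy := triple_sumP _ _ x1 (root_of_w_norm1 _ yn).
split; first exact: unit_triple_deltoid xy.
rewrite (p_unit_triple _ _ _ xy) !big_cons big_nil addr0 addrA exprVn exprMn xn yn.
by apply: cube_roots_sum; rewrite ?expr1n // eq_sym.
Qed.

(** The [n]-th powers of [x], [y] and [(x y)^-1] are the distinct numbers 1, [w]
    and [w^-1], which tells the elements of the unordered triple apart. *)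
Lemma triple_sum_inj x y x' y' :
  x ^+ n = 1 -> y ^+ n = w -> x' ^+ n = 1 -> y' ^+ n = w ->
  triple_sum x y = triple_sum x' y' -> x = x' /\ y = y'.
Proof.
move=> xn yn xn' yn' e.
have unit u v : u ^+ n = 1 -> v ^+ n = w ->
    unit_triples (triple_sum u v) [tuple u; v; (u * v)^-1].
  by move=> un vn; apply: triple_sumP;
    [exact: root_unity_norm1 n_gt0 un | exact: root_of_w_norm1].
have h := unit _ _ xn' yn'; rewrite -e in h.
have tw := perm_mem (unit_triple_unique _ _ _ h (unit _ _ xn yn)).
have w0 : w != 0 by rewrite norm1_neq0.
have wV : w^-1 != w.
  apply: contraNneq w_neq1 => wV.
  rewrite -w_cube (exprS _ 2) expr2 -[X in _ * (X * _)]wV.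
  by rewrite mulVf // mulr1.
have : x' \in [tuple x'; y'; (x' * y')^-1] by rewrite mem_head.
have : y' \in [tuple x'; y'; (x' * y')^-1] by rewrite !inE eqxx orbT.
rewrite !tw !inE => hy hx; split.
  case/or3P: hx => /eqP hx; rewrite hx //; case/eqP: w_neq1.
    by rewrite -yn -hx.
  by rewrite -[w]invrK -yn -[RHS]invr1 -xn' hx exprVn exprMn xn mul1r invrK.
case/or3P: hy => /eqP hy; rewrite hy //.
  by case/eqP: w_neq1; rewrite -yn' hy.
by case/eqP: wV; rewrite -{2}yn' hy exprVn exprMn xn yn mul1r.
Qed.

End Zeros.

(** * Indexing by exponents of a primitive root of unity *)

Section Parametrization.
Context {R : realType}.
Variables (n : nat) (n_gt0 : (0 < n)%N).

Let zeta : R[i] := cis (2 * pi / (3 * n)%:R).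

Let n3_gt0 : (0 < 3 * n)%N. Proof. by rewrite muln_gt0. Qed.

Let zeta_prim : (3 * n).-primitive_root zeta := prim_root_cis _ n3_gt0.

Let omega_prim : 3.-primitive_root (zeta ^+ n).
Proof.
by have := dvdn_prim_root zeta_prim (dvdn_mulr n (dvdnn 3)); rewrite mulKn.
Qed.

Let zeta3_prim : n.-primitive_root (zeta ^+ 3).
Proof.
by have := dvdn_prim_root zeta_prim (dvdn_mull 3 (dvdnn n)); rewrite mulnK.
Qed.

Let zeta_norm j : `|zeta ^+ j| = 1.
Proof. by rewrite normrX norm_cis expr1n. Qed.

Lemma meeting_pointE j1 j2 j3 :
  meeting_point R n j1 j2 j3 = zeta ^+ j1 + zeta ^+ j2 + zeta ^+ j3.
Proof. by rewrite /meeting_point -!cisMn ![_ / _ * _%:R]mulrAC. Qed.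

Lemma cis_needle_angle j : cis (- (2 * needle_angle R n j)) = zeta ^+ j.
Proof. by rewrite -cisMn /needle_angle mulrN opprK; congr cis; ring. Qed.

Lemma meeting_point_triple j1 j2 j3 : (3 * n %| j1 + j2 + j3)%N ->
  unit_triples (zeta ^+ j1 + zeta ^+ j2 + zeta ^+ j3)
    [tuple zeta ^+ j1; zeta ^+ j2; zeta ^+ j3].
Proof.
move=> j3n; apply/unit_triplesE; split=> //.
by apply/eqP; rewrite -!exprD -(prim_order_dvd zeta_prim).
Qed.

(** The residue of an exponent modulo 3 says of which cube root of unity the
    power of [zeta] is an [n]-th root. *)
Lemma zeta_powers_eq i j :
  ((zeta ^+ i) ^+ n == (zeta ^+ j) ^+ n) = (i == j %[mod 3])%N.
Proof.
by rewrite ![(zeta ^+ _) ^+ n]exprAC (eq_prim_root_expr omega_prim).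
Qed.

Lemma meeting_point_zero (j1 j2 j3 : 'I_(3 * n)) : admissible j1 j2 j3 ->
  p n (meeting_point R n j1 j2 j3) = 0.
Proof.
move=> [j12 j3n].
rewrite meeting_pointE (p_unit_triple _ _ _ (meeting_point_triple _ _ _ j3n)).
rewrite !big_cons big_nil addr0 addrA.
have cube j : ((zeta ^+ j) ^+ n) ^+ 3 = 1.
  by rewrite -exprM (mulnC n) exprAC (prim_expr_order zeta_prim) expr1n.
have neq : (zeta ^+ j1) ^+ n != (zeta ^+ j2) ^+ n by rewrite zeta_powers_eq.
rewrite -(cube_roots_sum _ _ (cube j1) (cube j2) neq); congr (_ + _).
have /unit_triplesE[_ _ _ z123 _] := meeting_point_triple _ _ _ j3n.
have z12 : zeta ^+ j1 * zeta ^+ j2 != 0 by rewrite mulf_neq0 ?norm1_neq0.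
rewrite -exprMn -exprVn; congr (_ ^+ n).
by apply: (mulfI z12); rewrite z123 mulfV.
Qed.

Lemma needles_meet (j1 j2 j3 : 'I_(3 * n)) : admissible j1 j2 j3 ->
  needle (needle_angle R n j1) `&` needle (needle_angle R n j2)
    `&` needle (needle_angle R n j3) = [set meeting_point R n j1 j2 j3].
Proof.
move=> [j12 j3n]; rewrite meeting_pointE.
have on (i j k : nat) : (3 * n %| i + j + k)%N ->
    needle (needle_angle R n i) (zeta ^+ i + zeta ^+ j + zeta ^+ k).
  move=> ijk; apply: needle_unit_triple (meeting_point_triple _ _ _ ijk) _.
  by rewrite cis_needle_angle.
have on1 := on _ _ _ j3n.
have on2 : needle (needle_angle R n j2) (zeta ^+ j1 + zeta ^+ j2 + zeta ^+ j3).
  by rewrite [zeta ^+ j1 + _]addrC; apply: on; rewrite [(j2 + _)%N]addnC.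
have on3 : needle (needle_angle R n j3) (zeta ^+ j1 + zeta ^+ j2 + zeta ^+ j3).
  by rewrite addrC addrA; apply: on; rewrite -addnA addnC.
apply/seteqP; split=> [z [[z1 z2] _]|_ ->] //=.
apply: needles_meet_once z1 z2 on1 on2.
have cisV j : cis (2 * needle_angle R n j) = (zeta ^+ j)^-1.
  apply: (mulfI (norm1_neq0 _ (zeta_norm j))); rewrite mulfV ?norm1_neq0 //.
  by rewrite -cis_needle_angle -cisD addNr cis0.
rewrite !cisV (inj_eq invr_inj); apply: contraNneq j12 => z12.
by rewrite -zeta_powers_eq z12.
Qed.

Lemma root_of_one (x : R[i]) : x ^+ n = 1 ->
  exists2 a, (a < n)%N & x = zeta ^+ (3 * a).
Proof. by case/(prim_rootP zeta3_prim) => a ->; exists a; rewrite ?exprM. Qed.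

Lemma root_of_omega (y : R[i]) : y ^+ n = zeta ^+ n ->
  exists2 b, (b < n)%N & y = zeta ^+ (3 * b + 1).
Proof.
have z0 : zeta != 0 by rewrite norm1_neq0 ?norm_cis.
move=> yn; have [|b bn yb] := root_of_one (y / zeta).
  by rewrite exprMn exprVn yn mulfV // expf_neq0.
by exists b => //; rewrite exprD -yb divfK.
Qed.

(** The [3 * a] are the exponents [j] for which [zeta ^+ j] is an [n]-th root of 1,
    and the [3 * b + 1] those for which it is an [n]-th root of [zeta ^+ n].  The triple of
    a zero has exactly one element of each kind. *)
Definition zero_of (a b : nat) : R[i] :=
  triple_sum (zeta ^+ (3 * a)) (zeta ^+ (3 * b + 1)).

Lemma zero_ofP z : deltoid z -> p n z = 0 ->
  exists a b, [/\ (a < n)%N, (b < n)%N & z = zero_of a b].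
Proof.
move=> zD zp; have [x [y [xn yn ->]]] := deltoid_zeroP _ _ omega_prim _ zD zp.
have [a an ->] := root_of_one _ xn; have [b bn ->] := root_of_omega _ yn.
by exists a, b.
Qed.

Let expr3a a : (zeta ^+ (3 * a)) ^+ n = 1.
Proof. by rewrite -exprM mulnAC exprM (prim_expr_order zeta_prim) expr1n. Qed.

Let expr3b b : (zeta ^+ (3 * b + 1)) ^+ n = zeta ^+ n.
Proof. by rewrite exprD exprMn expr3a mul1r. Qed.

Lemma zero_of_zero a b : deltoid (zero_of a b) /\ p n (zero_of a b) = 0.
Proof. exact: triple_sum_zero n_gt0 _ omega_prim _ _ (expr3a a) (expr3b b). Qed.

Lemma zero_of_inj a b a' b' : (a < n)%N -> (b < n)%N -> (a' < n)%N -> (b' < n)%N ->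
  zero_of a b = zero_of a' b' -> a = a' /\ b = b'.
Proof.
move=> an bn an' bn' /(triple_sum_inj _ n_gt0 _ omega_prim _ _ _ _ (expr3a a) (expr3b b)
  (expr3a a') (expr3b b'))[/eqP + /eqP].
rewrite !(eq_prim_root_expr zeta_prim) !modn_small; lia.
Qed.

Lemma card_zeros : [set z : R[i] | deltoid z /\ p n z = 0] #= `I_(n ^ 2).
Proof.
pose f k := zero_of (k %/ n) (k %% n).
have -> : [set z : R[i] | deltoid z /\ p n z = 0] = f @` `I_(n ^ 2).
  apply/seteqP; split=> [z [zD zp]|_ [k _ <-]]; last exact: zero_of_zero.
  have [a [b [an bn ->]]] := zero_ofP _ zD zp.
  exists (a * n + b)%N; first by rewrite /=; nia.
  by rewrite /f divnMDl // divn_small // addn0 modnMDl modn_small.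
apply: inj_card_eq => k l /set_mem /= kn /set_mem /= ln.
have div_lt m : (m < n ^ 2)%N -> (m %/ n < n)%N by rewrite ltn_divLR.
case/zero_of_inj; rewrite ?div_lt ?ltn_pmod // => ed em.
by rewrite (divn_eq k n) ed em -divn_eq.
Qed.

Lemma zero_of_meeting_point a b : (a < n)%N -> (b < n)%N ->
  exists j1 j2 j3 : 'I_(3 * n),
    admissible j1 j2 j3 /\ zero_of a b = meeting_point R n j1 j2 j3.
Proof.
move=> an bn.
have l1 : (3 * a < 3 * n)%N by lia.
have l2 : (3 * b + 1 < 3 * n)%N by lia.
(* The multiple [2 * (3 * n)] keeps the subtraction from truncating. *)
pose j := (2 * (3 * n) - (3 * a + (3 * b + 1)))%N.
have l3 : (j %% (3 * n) < 3 * n)%N by rewrite ltn_pmod.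
have j3n : (3 * n %| 3 * a + (3 * b + 1) + j %% (3 * n))%N.
  by rewrite /dvdn modnDmr /j subnKC ?modnMl //; lia.
exists (Ordinal l1), (Ordinal l2), (Ordinal l3); split.
  by split=> //=; rewrite mulnC modnMl mulnC modnMDl.
rewrite meeting_pointE /=.
have /unit_triplesE[_ _ _ z123 _] := meeting_point_triple _ _ _ j3n.
have z12 : zeta ^+ (3 * a) * zeta ^+ (3 * b + 1) != 0 by rewrite mulf_neq0 ?norm1_neq0.
by congr (_ + _); apply: (mulfI z12); rewrite z123 mulfV.
Qed.

End Parametrization.

Local Open Scope complex_scope.
Local Open Scope card_scope.

Theorem theorem5p7 (R : realType) (n : nat) (n_gt0 : (0 < n)%N) :
  [/\ forall j1 j2 j3 : 'I_(3 * n), admissible j1 j2 j3 ->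
        [/\ needle (needle_angle R n j1) `&` needle (needle_angle R n j2)
              `&` needle (needle_angle R n j3)
              = [set meeting_point R n j1 j2 j3],
            deltoid (meeting_point R n j1 j2 j3)
          & p n (meeting_point R n j1 j2 j3) = 0],
      [set z : R[i] | deltoid z /\ p n z = 0] #= `I_(n ^ 2)
    & forall z : R[i], deltoid z -> p n z = 0 ->
        exists j1 j2 j3 : 'I_(3 * n),
          admissible j1 j2 j3 /\ z = meeting_point R n j1 j2 j3].
Proof.
split=> [j1 j2 j3 adm||z zD zp].
- split; [exact: needles_meet | | exact: meeting_point_zero].
  have [_ j3n] := adm; rewrite meeting_pointE.
  exact: unit_triple_deltoid (meeting_point_triple _ n_gt0 _ _ _ j3n).
- exact: card_zeros.
- have [a [b [an bn ->]]] := zero_ofP _ n_gt0 _ zD zp.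
  exact: zero_of_meeting_point.
Qed.
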